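(* Let $\mathcal F=\{f_i\}_{i\in[m]}$ and $\mathcal G=\{g_i\}_{i\in[m]}$ be two woven frame sequences in $\mathcal H^n$. Then for every non-trivial $\sigma\subset[m]$, $$\hat\delta\big(\operatorname{span}(\mathcal F_\sigma\cup\mathcal G_{\sigma^c}),\ \operatorname{span}(\mathcal F_{\sigma^c}\cup\mathcal G_\sigma)\big)=0.$$
   Context: $[m]=\{1,\dots,m\}$, $\mathcal H^n$ is an $n$-dimensional Hilbert space, and $\sigma^c=[m]\setminus\sigma$; $\sigma$ is non-trivial if $\sigma\ne\emptyset$ and $\sigma\neq[m]$. For $\tau\subseteq[m]$, $\mathcal F_\tau=\{f_i\}_{i\in\tau}$ and $\mathcal G_\tau=\{g_i\}_{i\in\tau}$. A family $\{f_i\}_{i\in I}$ in a Hilbert space $\mathcal H$ is a frame for $\mathcal H$ if there are constants $A,B>0$ with $A\|f\|^2\le\sum_{i\in I}|\langle f,f_i\rangle|^2\le B\|f\|^2$ for all $f\in\mathcal H$; it is a frame sequence in $\mathcal H$ if it is a frame for its closed linear span. Two frame sequences $\{f_i\}_{i\in I}$ and $\{g_i\}_{i\in I}$ in $\mathcal H$ are woven frame sequences if for every $\sigma\subset I$ the family $\{f_i\}_{i\in\sigma}\cup\{g_i\}_{i\in\sigma^c}$ (counted with multiplicity) is a frame for $\mathcal H$. For closed subspaces $M,N$ of a Hilbert space, the gap is $\hat\delta(M,N)=\max\{\delta(M,N),\delta(N,M)\}$, where $\delta(M,N)=\sup_{x\in S_M}\operatorname{dist}(x,N)$, $S_M$ is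 the unit sphere of $M$, and $\operatorname{dist}(x,N)$ is the distance from $x$ to $N$. *)

(* Defs.v *)
From HB Require Import structures.
From mathcomp Require Import all_boot all_order all_algebra.
From mathcomp Require Import complex.
From mathcomp Require Import boolp classical_sets reals.

Set Implicit Arguments.
Unset Strict Implicit.
Unset Printing Implicit Defensive.

Import Order.TTheory GRing.Theory Num.Theory.
Local Open Scope ring_scope.
Local Open Scope classical_set_scope.

(* A Hilbert space may be real or complex: [scalars R k] is R or R[i]. *)
Variant scalar_kind := RealScalars | ComplexScalars.

Definition scalars (R : realType) (k : scalar_kind) : numFieldType :=
  match k with RealScalars => R | ComplexScalars => R[i] end.

Definition conjs (R : realType) (k : scalar_kind) :
    {rmorphism scalars R k -> scalars R k} :=
  match k with RealScalars => idfun | ComplexScalars => @conjc R end.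

Definition Res (R : realType) (k : scalar_kind) : scalars R k -> R :=
  match k with RealScalars => id | ComplexScalars => @complex.Re R end.

Section Hilbert.
Variables (R : realType) (k : scalar_kind).
(* An n-dimensional Hilbert space is a vectType of dimension n with a positive
   definite hermitian form; all its linear subspaces are closed. *)
Variables (H : vectType (scalars R k)) (ip : {dot H for @conjs R k}).

(* MathComp's norm on R[i] takes its (real) values in R[i]. *)
Definition modulus (z : scalars R k) : R := Res `|z|.

Definition hnorm (x : H) : R := Num.sqrt (Res (ip x x)).

(* A frame for a subspace M is a family of vectors of M. *)
Definition is_frame (I : finType) (M : {vspace H}) (f : I -> H) : Prop :=
  (forall i, f i \in M) /\
  exists A B : R, [/\ 0 < A, 0 < B &
    forall x, x \in M ->
      A * hnorm x ^+ 2 <= \sum_i modulus (ip x (f i)) ^+ 2 <= B * hnorm x ^+ 2].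

Definition is_frame_sequence (I : finType) (f : I -> H) : Prop :=
  is_frame <<codom f>>%VS f.

(* The union, counted with multiplicity, of {f_i}, i in sigma, and
   {g_i}, i not in sigma. *)
Definition weave (I : finType) (f g : I -> H) (sigma : {set I}) (i : I) : H :=
  if i \in sigma then f i else g i.

Definition woven_frame_sequences (I : finType) (f g : I -> H) : Prop :=
  [/\ is_frame_sequence f, is_frame_sequence g &
      forall sigma : {set I}, is_frame fullv (weave f g sigma)].

Definition dist (x : H) (N : {vspace H}) : R :=
  inf [set hnorm (x - y) | y in [set y | y \in N]].

(* The unit sphere of M = 0 is empty; as [sup set0 = 0], delta 0 N = 0. *)
Definition delta (M N : {vspace H}) : R :=
  sup [set dist x N | x in [set x | x \in M /\ hnorm x = 1]].

Definition gap (M N : {vspace H}) : R := Num.max (delta M N) (delta N M).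

End Hilbert.

(* Main.v *)
From HB Require Import structures.
From mathcomp Require Import complex classical_sets.
Require Import Defs.
From mathcomp Require Import all_boot all_order all_algebra.
From mathcomp Require Import reals.

(** Both subspaces are the whole space.  The lower bound of a frame for [H]
    shows that a vector orthogonal to every frame vector has norm [0], hence
    is [0]; since the orthogonal complement of a proper subspace of a
    finite-dimensional space is nonzero ([span_orthogonal_eq0]), a frame for
    [H] spans [H] ([frame_span_full]).  In a pair of woven frame sequences the
    weaving along [sigma] and the weaving along its complement are both frames
    for [H], so the two spans coincide, and a subspace has gap [0] to itself
    ([gapxx]). *)

Import Order.TTheory GRing.Theory Num.Theory.
Local Open Scope ring_scope.

Section Hilbert.
Variables (R : realType) (k : scalar_kind).
Variables (H : vectType (scalars R k)) (ip : {dot H for @conjs R k}).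

Let Res_gt0 (z : scalars R k) : 0 < z -> 0 < Res z.
Proof. by case: k z => //= z; rewrite ltcE /= => /andP[]. Qed.

Let modulus0 : modulus (0 : scalars R k) = 0.
Proof. by rewrite /modulus normr0; case: k. Qed.

Lemma hnorm0 : hnorm ip 0 = 0.
Proof. by rewrite /hnorm linear0l; case: k => /=; rewrite sqrtr0. Qed.

Lemma hnorm_gt0 x : x != 0 -> 0 < hnorm ip x.
Proof. by move=> x0; rewrite sqrtr_gt0 Res_gt0 ?neq0_dnorm_gt0. Qed.

Lemma dist_mem x (N : {vspace H}) : x \in N -> dist ip x N = 0.
Proof.
move=> xN; rewrite /dist; set D := (X in inf X).
have D_ge0 : lbound D 0 by move=> _ [y _ <-]; exact: sqrtr_ge0.
have D0 : D 0 by exists x => //; rewrite subrr hnorm0.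
apply/eqP; rewrite eq_le ge_inf //; last by exists 0.
by apply: lb_le_inf => //; exists 0.
Qed.

(** The supremum is over [{0}] or, when the unit sphere of [M] is empty, over
    the empty set, where it is [0] by convention. *)
Lemma delta_subv (M N : {vspace H}) : (M <= N)%VS -> delta ip M N = 0.
Proof.
move=> /subvP MN; rewrite /delta; set D := (X in sup X).
have : (D `<=` [set 0])%classic.
  by move=> _ [x [xM _] <-]; exact/dist_mem/MN.
by move=> /subset_set1[] ->; [exact: sup0 | exact: sup1].
Qed.

Lemma gapxx (M : {vspace H}) : gap ip M M = 0.
Proof. by rewrite /gap delta_subv // maxxx. Qed.

(** With [b] a basis of the span, the linear map sending [x] to the scalars
    [ip x b_i] is injective, because a vector of its kernel is orthogonal to
    the whole span; so the dimension of [H] is at most the number of basis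
    vectors. *)
Lemma span_orthogonal_eq0 (X : seq H) :
  (forall x, (forall y, y \in X -> ip x y = 0) -> x = 0) ->
  <<X>>%VS = fullv.
Proof.
move=> X_perp; set b := vbasis <<X>>.
pose phi x : 'rV[scalars R k]_(\dim <<X>>) := \row_i ip x b`_i.
have phi_lin : linear phi.
  by move=> a u v; apply/rowP => i; rewrite !mxE linearPl.
pose phiL := GRing.isLinear.Build _ _ _ _ phi phi_lin.
pose philin : {linear H -> _} := HB.pack phi phiL.
have ker0 : lker (linfun philin) = 0%VS.
  apply/eqP; rewrite -subv0; apply/subvP => x.
  rewrite memv_ker lfunE /= => /eqP /rowP phix0; rewrite memv0.
  apply/eqP/X_perp => y /memv_span /coord_vbasis ->.
  rewrite linear_sum big1 // => i _.
  by rewrite linearZ /=; have := phix0 i; rewrite !mxE => ->; rewrite mulr0.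
apply/eqP; rewrite eqEdim subvf /=.
rewrite -(limg_dim_eq (f := linfun philin)) ?ker0 ?capv0 //.
by rewrite (leq_trans (dimvS (subvf _))) // dimvf /dim /= mul1n.
Qed.

Lemma frame_span_full (I : finType) (h : I -> H) (X : seq H) :
  is_frame ip fullv h -> (forall i, h i \in X) -> <<X>>%VS = fullv.
Proof.
move=> [_ [A [B [A_gt0 _ h_frame]]]] hX.
apply: span_orthogonal_eq0 => x x_perp; apply/eqP/negP => /negP x0.
have /andP[+ _] := h_frame x (memvf x).
rewrite big1 => [|i _]; last by rewrite x_perp // modulus0 expr0n.
by rewrite leNgt mulr_gt0 // exprn_gt0 // hnorm_gt0.
Qed.

End Hilbert.

Arguments frame_span_full {R k H ip I h} X.

Theorem theorem4p4 (R : realType) (k : scalar_kind) (n m : nat)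
    (H : vectType (scalars R k)) (ip : {dot H for @conjs R k})
    (dimH : \dim {:H} = n) (f g : 'I_m -> H)
    (fg_woven : woven_frame_sequences ip f g)
    (sigma : {set 'I_m}) (sigma_neq0 : sigma <> set0)
    (sigma_neqT : sigma <> [set: 'I_m]) :
  gap ip <<[seq f i | i in sigma] ++ [seq g i | i in ~: sigma]>>%VS
         <<[seq f i | i in ~: sigma] ++ [seq g i | i in sigma]>>%VS = 0.
Proof.
have [_ _ weave_frame] := fg_woven.
rewrite (frame_span_full _ (weave_frame sigma)); last first.
  move=> i; rewrite /weave mem_cat; case: ifPn => i_sigma.
    by rewrite image_f.
  by rewrite [X in _ || X]image_f ?orbT // inE.
rewrite (frame_span_full _ (weave_frame (~: sigma))); last first.
  move=> i; rewrite /weave mem_cat; case: ifPn => i_sigma.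
    by rewrite image_f.
  by rewrite [X in _ || X]image_f ?orbT //; rewrite inE negbK in i_sigma.
exact: gapxx.
Qed.
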